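(* Let $m$ be a negative integer and consider link diagrams $L_0, L_+, L_\infty$ and $L_m$ which are identical except within a ball (disk), where they are respectively the tangles $[0]$, $X$, $[\infty]$, and a horizontal row of $|m|$ crossings each equal to $\overline{X}$. Then $$P(L_m)=A_mP(L_+)+B_mP(L_0)-C_mP(L_\infty),$$ where $$A_m=B_{m+1}\ \text{ for } m<-1,\qquad A_{-1}=1,$$ $$B_m=\sum_{i=0}^{\lfloor |m|/2\rfloor}(-z)^{|m|-2i}\binom{|m|-i}{i},$$ $$C_m=\sum_{j=1}^{|m|}\ \sum_{i=0}^{\lfloor (j-1)/2\rfloor}(-z)^{j-2i}a^{|m|-j}\binom{j-1-i}{i}.$$
   Context: All links are unoriented and given by planar diagrams. Inside a disk with four boundary points NW, NE, SW, SE consider four tangles: the crossing $X$, in which the strand joining NW to SE passes over the strand joining SW to NE; the switched crossing $\overline{X}$, in which the strand joining SW to NE passes over the strand joining NW to SE; the tangle $[0]$, consisting of two crossingless arcs NW--NE and SW--SE; and the tangle $[\infty]$, consisting of two crossingless arcs NW--SW and NE--SE. A horizontal row of $k$ crossings $\overline{X}$ is the tangle obtained by placing $k$ copies of $\overline{X}$ side by side from left to right, joining the NE and SE endpoints of each copy to the NW and SW endpoints, respectively, of the next one (so it consists of $k$ half-twists). Dubrovnik polynomial: $P(K)=P(K)(z,a)\in\mathbb{Z}[a^{\pm1},z^{\pm1}]$ is the unique function of unoriented link diagrams $K$ such that (1) $P$ is invariant under regular isotopy (planar isotopy and Reidemeister moves II and III); (2) $P(K_X)-P(K_{\overline{X}})=z\,[P(K_{[0]})-P(K_{[\infty]})]$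 whenever the four diagrams are identical outside a disk in which they are the indicated tangles; (3) $P(\text{diagram with positive curl})=a\,P(\text{diagram with the curl removed})$ and $P(\text{diagram with negative curl})=a^{-1}P(\text{diagram with the curl removed})$, where a curl is a Reidemeister I kink, and it is positive or negative according to the sign of its crossing (which does not depend on the orientation); (4) $P$ of the crossingless diagram of the unknot is $1$. *)

(* Defs.v *)
From HB Require Import structures.
From mathcomp Require Import all_boot all_order all_algebra.
From Stdlib Require Import Relation_Operators.

Set Implicit Arguments.
Unset Strict Implicit.
Unset Printing Implicit Defensive.

Import GRing.Theory Num.Theory.
Local Open Scope ring_scope.

(** * Link diagrams

    A planar diagram in general position with respect to the horizontal
    coordinate is swept from left to right.  Between two consecutive critical
    abscissas the vertical line meets the diagram in finitely many strands,
    numbered 0, 1, 2, ... from top to bottom; at each critical abscissa exactly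
    one of the following pieces occurs, the other strands going straight:
    - [Open]    an arc with a leftmost point, i.e. two new strands are born;
    - [Close]   an arc with a rightmost point, i.e. two strands are joined;
    - [Cross X]     the strand joining NW to SE passes over the other one;
    - [Cross Xbar]  the strand joining SW to NE passes over the other one.
    The slice [(p, i)] is the piece [p] having exactly [i] strands above it, so
    a crossing or a [Close] involves the strands [i] and [i + 1] on its left,
    and a crossing or an [Open] yields the strands [i] and [i + 1] on its
    right. *)

Inductive crossing := X | Xbar.

Definition switch (c : crossing) : crossing :=
  match c with X => Xbar | Xbar => X end.

Inductive piece := Open | Close | Cross of crossing.

Definition slice := (piece * nat)%type.

Definition ins (p : piece) : nat := if p is Open then 0%N else 2%N.
Definition outs (p : piece) : nat := if p is Close then 0%N else 2%N.

Definition step (n : nat) (s : slice) : option nat :=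
  if (s.2 + ins s.1 <= n)%N then Some (n - ins s.1 + outs s.1)%N else None.

(** [None] when some slice uses a strand that does not exist. *)
Definition strands (w : seq slice) : option nat :=
  foldl (fun o s => obind (step^~ s) o) (Some 0%N) w.

(** The empty diagram is excluded: the axioms of the Dubrovnik polynomial would
    not determine its value. *)
Record link_diagram := LinkDiagram {
  word :> seq slice;
  word_nonempty : ~~ nilp word;
  word_closed : strands word == Some 0%N
}.

(** * Planar and regular isotopy

    Two such diagrams are planar isotopic iff they are related by a sequence
    of the following moves: exchange of two consecutive independent pieces,
    straightening of a zigzag, and rotation of a crossing next to an extremum
    (the arc carrying the extremum passes over, resp. under, the same strand on
    both sides of the rule). *)
Inductive planar_rule : seq slice -> seq slice -> Prop :=
| Exchange (p q : piece) (i j : nat) : (i <= j)%N ->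
    planar_rule [:: (p, i); (q, j + outs p)%N] [:: (q, j + ins p)%N; (p, i)]
| ZigzagUp (i : nat) :
    planar_rule [:: (Open, i); (Close, i.+1)] [::]
| ZigzagDown (i : nat) :
    planar_rule [:: (Open, i.+1); (Close, i)] [::]
| RotateClose (c : crossing) (i : nat) :
    planar_rule [:: (Cross c, i); (Close, i.+1)]
                [:: (Cross (switch c), i.+1); (Close, i)]
| RotateOpen (c : crossing) (i : nat) :
    planar_rule [:: (Open, i.+1); (Cross c, i)]
                [:: (Open, i); (Cross (switch c), i.+1)].

(** In [ReidemeisterIII] the strands entering at [i], [i + 1], [i + 2] cross
    pairwise with types [c12], [c13], [c23] on both sides; the side condition
    says that one of the three strands is above the two others, one is below
    the two others. *)
Inductive regular_rule : seq slice -> seq slice -> Prop :=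
| Planar (u v : seq slice) : planar_rule u v -> regular_rule u v
| ReidemeisterII (c : crossing) (i : nat) :
    regular_rule [:: (Cross c, i); (Cross (switch c), i)] [::]
| ReidemeisterIII (c12 c13 c23 : crossing) (i : nat) :
    c13 = c12 \/ c13 = c23 ->
    regular_rule [:: (Cross c12, i); (Cross c13, i.+1); (Cross c23, i)]
                 [:: (Cross c23, i.+1); (Cross c13, i); (Cross c12, i.+1)].

Definition apply_rule (rule : seq slice -> seq slice -> Prop)
    (D E : link_diagram) : Prop :=
  exists pre u v post : seq slice,
    [/\ rule u v, word D = pre ++ u ++ post & word E = pre ++ v ++ post].

Definition planar_isotopic : link_diagram -> link_diagram -> Prop :=
  clos_refl_sym_trans link_diagram (apply_rule planar_rule).

Definition regular_isotopic : link_diagram -> link_diagram -> Prop :=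
  clos_refl_sym_trans link_diagram (apply_rule regular_rule).

(** * Diagrams that are identical outside a disk

    By a planar isotopy a disk can be moved to a box which is traversed by the
    sweep between the words [pre] and [post] describing the outside; NW and SW
    are then the strands [i], [i + 1] on the left of the box, and NE and SE the
    strands [i], [i + 1] on its right.  Diagrams agreeing outside the disk are
    those sharing [pre], [i] and [post]. *)
Definition looks_like (D : link_diagram) (pre tangle post : seq slice) : Prop :=
  exists2 E : link_diagram, word E = pre ++ tangle ++ post & planar_isotopic D E.

Definition tangle_X (i : nat) : seq slice := [:: (Cross X, i)].
Definition tangle_Xbar (i : nat) : seq slice := [:: (Cross Xbar, i)].
Definition tangle_0 (i : nat) : seq slice := [::].
Definition tangle_infty (i : nat) : seq slice := [:: (Close, i); (Open, i)].
Definition row_Xbar (k i : nat) : seq slice := nseq k (Cross Xbar, i).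

(** The two kinks that can be put on the strand [i], with the loop below or
    above it.  Both branches traverse the crossing rightwards (or both
    leftwards), so the crossing is positive if it is [X] and negative if it is
    [Xbar]. *)
Definition curl_below (c : crossing) (i : nat) : seq slice :=
  [:: (Open, i.+1); (Cross c, i); (Close, i.+1)].
Definition curl_above (c : crossing) (i : nat) : seq slice :=
  [:: (Open, i); (Cross c, i.+1); (Close, i)].

Definition unknot : link_diagram :=
  @LinkDiagram [:: (Open, 0%N); (Close, 0%N)] isT isT.

(** * Laurent polynomials in [a] and [z]

    Z[a^+-1, z^+-1] is the subring of the fraction field of Z[z][a] consisting
    of the fractions whose denominator is a power of [a * z]. *)
Definition ratfun : fieldType := {fraction {poly {poly int}}}.

Definition va : ratfun := tofrac ('X : {poly {poly int}}).
Definition vz : ratfun := tofrac (('X : {poly int})%:P : {poly {poly int}}).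

Definition laurent (x : ratfun) : Prop :=
  exists (p : {poly {poly int}}) (n : nat), x = tofrac p / (va * vz) ^+ n.

(** * The Dubrovnik polynomial *)
Record is_dubrovnik (P : link_diagram -> ratfun) : Prop := IsDubrovnik {
  dubrovnik_laurent : forall D, laurent (P D);
  dubrovnik_isotopy : forall D E, regular_isotopic D E -> P D = P E;
  dubrovnik_skein : forall (pre post : seq slice) (i : nat)
      (KX KXbar K0 Kinfty : link_diagram),
    looks_like KX pre (tangle_X i) post ->
    looks_like KXbar pre (tangle_Xbar i) post ->
    looks_like K0 pre (tangle_0 i) post ->
    looks_like Kinfty pre (tangle_infty i) post ->
    P KX - P KXbar = vz * (P K0 - P Kinfty);
  dubrovnik_positive_curl : forall (pre post : seq slice) (i : nat)
      (D E : link_diagram),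
    looks_like D pre (curl_below X i) post \/
      looks_like D pre (curl_above X i) post ->
    looks_like E pre [::] post ->
    P D = va * P E;
  dubrovnik_negative_curl : forall (pre post : seq slice) (i : nat)
      (D E : link_diagram),
    looks_like D pre (curl_below Xbar i) post \/
      looks_like D pre (curl_above Xbar i) post ->
    looks_like E pre [::] post ->
    P D = va^-1 * P E;
  dubrovnik_unknot : P unknot = 1
}.

(** * The coefficients *)
Definition skeinB (m : int) : ratfun :=
  \sum_(0 <= i < (`|m|%N %/ 2).+1)
    (- vz) ^+ (`|m|%N - 2 * i) * 'C(`|m|%N - i, i)%:R.

Definition skeinA (m : int) : ratfun :=
  if m == -1 then 1 else skeinB (m + 1).

Definition skeinC (m : int) : ratfun :=
  \sum_(1 <= j < `|m|%N.+1) \sum_(0 <= i < ((j - 1) %/ 2).+1)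
    (- vz) ^+ (j - 2 * i) * va ^+ (`|m|%N - j) * 'C(j - 1 - i, i)%:R.

(* Main.v *)
Require Import Defs.
From HB Require Import structures.
From mathcomp Require Import all_boot all_order all_algebra.
From mathcomp Require Import zify ring.
From Stdlib Require Import Relation_Operators.

Import GRing.Theory.
Local Open Scope ring_scope.

(** Resolving the leftmost crossing of a row of k + 1 crossings gives
    x(k+1) = x(k-1) - z x(k) + z a^k P(L_infty), where x(k) is the value of the
    row of k crossings and x(-1) that of L_+: the switched crossing cancels with
    its neighbour, and in the smoothing [infty] the k remaining crossings are
    positive kinks.  The coefficients satisfy the matching recurrences
    b(k+2) = - z b(k+1) + b(k) and c(k+1) = a c(k) - z b(k). *)

(** * Words of slices *)

Definition is_closed (w : seq slice) : bool :=
  ~~ nilp w && (strands w == Some 0%N).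

(* Takes the junk value [unknot] on words that are not closed. *)
Definition diagram_of (w : seq slice) : link_diagram :=
  (if is_closed w as b return is_closed w = b -> link_diagram
   then fun h => @LinkDiagram w (proj1 (andP h)) (proj2 (andP h))
   else fun=> unknot) erefl.

Lemma word_diagram_of {w} : is_closed w -> word (diagram_of w) = w.
Proof.
by move=> h; rewrite /diagram_of; move: erefl; rewrite {2 3}h.
Qed.

(** An arbitrary initial strand count allows a word to be cut into factors; [strands] is the case
    [n = 0], by conversion. *)
Definition run (n : nat) (w : seq slice) : option nat :=
  foldl (fun o s => obind (step^~ s) o) (Some n) w.

Lemma run_cat n w1 w2 : run n (w1 ++ w2) = obind (run^~ w2) (run n w1).
Proof.
rewrite /run foldl_cat; case: (foldl _ _ w1) => //=.
by elim: w2.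
Qed.

Lemma run_cat_some {n k w1} w2 : run n w1 = Some k -> run n (w1 ++ w2) = run k w2.
Proof. by move=> h; rewrite run_cat h. Qed.

Lemma run_cons {n s} w : (s.2 + ins s.1 <= n)%N ->
  run n (s :: w) = run (n - ins s.1 + outs s.1)%N w.
Proof. by rewrite /run /= /step => ->. Qed.

Lemma run_nseq_cross c n k i : (i.+2 <= n)%N ->
  run n (nseq k (Cross c, i)) = Some n.
Proof.
move=> hi; elim: k => // k IH; rewrite run_cons /= ?subnK //; lia.
Qed.

(** The condition [0 < k] excludes the empty diagram: if [pre] and [t] were both empty, no strand
    would leave the box. *)
Lemma is_closed_box {n k pre t post} : run 0 pre = Some n -> run n t = Some k ->
  run k post = Some 0%N -> (0 < k)%N -> is_closed (pre ++ t ++ post).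
Proof.
move=> hpre ht hpost k_gt0; apply/andP; split; last first.
  by rewrite -[strands _]/(run 0 _) (run_cat_some _ hpre) (run_cat_some _ ht) hpost.
apply: contraTN k_gt0; rewrite !cat_nilp; case/and3P=> /nilP pre0 /nilP t0 _.
move: hpre ht.
by rewrite pre0 t0 => -[<-] [<-].
Qed.

Lemma link_diagram_inj (D E : link_diagram) : word D = word E -> D = E.
Proof.
case: D E => [w n c] [w' n' c'] /= eq_w; subst w'.
by rewrite (bool_irrelevance n n') (bool_irrelevance c c').
Qed.

Lemma looks_like_diagram_of {pre t post} : is_closed (pre ++ t ++ post) ->
  looks_like (diagram_of (pre ++ t ++ post)) pre t post.
Proof.
by move=> h; exists (diagram_of (pre ++ t ++ post));
  [exact: word_diagram_of | exact: rst_refl].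
Qed.

Lemma looks_like_closed {D pre t post} : looks_like D pre t post ->
  is_closed (pre ++ t ++ post).
Proof. by case=> E <- _; apply/andP; split; [exact: word_nonempty | exact: word_closed]. Qed.

Lemma planar_regular {D E} : planar_isotopic D E -> regular_isotopic D E.
Proof.
elim=> [{}D {}E [pre [u [v [post [uv hD hE]]]]]|{}D|{}D {}E _|x y w _ xy _ yw].
- by apply: rst_step; exists pre, u, v, post; split=> //; exact: Planar.
- exact: rst_refl.
- exact: rst_sym.
- exact: rst_trans xy yw.
Qed.

(** The [Close] of the smoothing consumes the strands [i] and [i + 1], so both must exist; the
    [Open] then restores the count [n]. *)
Lemma closed_infty_box {pre i post} :
  is_closed (pre ++ tangle_infty i ++ post) ->
  exists n, [/\ run 0 pre = Some n, (i.+2 <= n)%N & run n post = Some 0%N].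
Proof.
case/andP=> _; rewrite -[strands _]/(run 0 _) run_cat.
case: (run 0 pre) => [n|] //=; have [hi|hi] := leqP i.+2 n; last first.
  have -> : run n [:: (Close, i), (Open, i) & post] = None; last by [].
  rewrite /run /= /step /= addn2 leqNgt hi /=.
  by elim: post.
rewrite run_cons /= ?addn2 // run_cons /=; last by lia.
have -> : (n - 2 + 0 - 0 + 2 = n)%N by lia.
by move=> /eqP hpost; exists n.
Qed.

(** * Values of the Dubrovnik polynomial *)

Section Values.
Variables (P : link_diagram -> ratfun) (hP : is_dubrovnik P).

Local Notation value w := (P (diagram_of w)).

Lemma value_looks_like {D pre t post} : looks_like D pre t post ->
  P D = value (pre ++ t ++ post).
Proof.
move=> h; have cl := looks_like_closed h; case: h => E hE DE.
rewrite (dubrovnik_isotopy hP (planar_regular DE)).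
by congr P; apply: link_diagram_inj; rewrite (word_diagram_of cl).
Qed.

Lemma value_rule {n k pre u v post} : regular_rule u v ->
  run 0 pre = Some n -> run n u = Some k -> run n v = Some k ->
  run k post = Some 0%N -> (0 < k)%N ->
  value (pre ++ u ++ post) = value (pre ++ v ++ post).
Proof.
move=> uv hpre hu hv hpost k_gt0; apply: (dubrovnik_isotopy hP).
apply: rst_step; exists pre, u, v, post; split=> //; apply: word_diagram_of.
- exact: is_closed_box hpre hu hpost k_gt0.
- exact: is_closed_box hpre hv hpost k_gt0.
Qed.

Lemma value_rule_in {n k n1 k1 pre post} l r {u v} : regular_rule u v ->
  run 0 pre = Some n -> run n l = Some n1 -> run n1 u = Some k1 ->
  run n1 v = Some k1 -> run k1 r = Some k -> run k post = Some 0%N ->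
  (0 < k1)%N ->
  value (pre ++ (l ++ u ++ r) ++ post) = value (pre ++ (l ++ v ++ r) ++ post).
Proof.
move=> uv hpre hl hu hv hr hpost k1_gt0; rewrite -!catA !(catA pre).
apply: (value_rule uv (n := n1) (k := k1)) => //.
- by rewrite (run_cat_some _ hpre).
- by rewrite (run_cat_some _ hr).
Qed.

(* An [Xbar] whose two left ends are joined is traversed once rightwards and once
   leftwards, so it is a positive kink.  Read backwards, the rewriting slides
   the curl [curl_above X i] over the leftmost point of its strand. *)
Lemma value_open_Xbar {n i pre post} : run 0 pre = Some n -> (i <= n)%N ->
  run n.+2 post = Some 0%N ->
  value (pre ++ [:: (Open, i); (Cross Xbar, i)] ++ post) =
    va * value (pre ++ [:: (Open, i)] ++ post).
Proof.
move=> hpre hi hpost.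
have runE m s : (s.2 + ins s.1 <= m)%N ->
  run m [:: s] = Some (m - ins s.1 + outs s.1)%N.
  by move=> h; rewrite run_cons.
have run2E m k s t : (s.2 + ins s.1 <= m)%N ->
    (t.2 + ins t.1 <= m - ins s.1 + outs s.1)%N ->
    (m - ins s.1 + outs s.1 - ins t.1 + outs t.1 = k)%N ->
  run m [:: s; t] = Some k.
  by move=> h1 h2 <-; rewrite run_cons // run_cons.
have hO : run n [:: (Open, i)] = Some n.+2 by rewrite runE /= ?subn0 ?addn2 ?addn0.
(* Inserting a zigzag gives [Open i; Open i.+1; Close i; Xbar i]. Next, [Xbar] passes left of
   [Close] to position [i.+2], is rotated with the second [Open] into [Open i.+2; X i.+1], and the
   two [Open] slices are exchanged. *)
rewrite -(value_rule_in [:: (Open, i)] [:: (Cross Xbar, i)]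
  (Planar (ZigzagDown i)) (n := n) (k := n.+2) (n1 := n.+2) (k1 := n.+2)) //;
  [| apply: run2E => /=; lia | by rewrite runE /=; [congr Some|]; lia].
have := Exchange Close (Cross Xbar) (leqnn i); rewrite /= addn0 addn2 => ex.
rewrite (value_rule_in [:: (Open, i); (Open, i.+1)] [::] (Planar ex)
  (n := n) (k := n.+2) (n1 := n.+4) (k1 := n.+2)) //;
  [| by apply: run2E => /=; lia ..].
rewrite -(value_rule_in [:: (Open, i)] [:: (Close, i)]
  (Planar (RotateOpen X i.+1)) (n := n) (k := n.+2) (n1 := n.+2) (k1 := n.+4)) //;
  [| by apply: run2E => /=; lia .. | by rewrite runE /=; [congr Some|]; lia].
have := Exchange Open Open (leqnn i); rewrite /= addn0 addn2 => ex'.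
rewrite (value_rule_in [::] [:: (Cross X, i.+1); (Close, i)] (Planar ex')
  (n := n) (k := n.+2) (n1 := n) (k1 := n.+4)) //;
  [| by apply: run2E => /=; lia ..].
have hpre' : run 0 (pre ++ [:: (Open, i)]) = Some n.+2.
  by rewrite (run_cat_some _ hpre).
rewrite -[_ ++ _ ++ post]/(pre ++ [:: (Open, i)] ++ curl_above X i ++ post).
rewrite !(catA pre).
apply: (dubrovnik_positive_curl hP (pre := pre ++ [:: (Open, i)]) (i := i) (post := post)).
  right; apply: looks_like_diagram_of.
  apply: (is_closed_box (k := n.+2) hpre') => //.
  by rewrite /curl_above run_cons /=; [apply: run2E => /=|]; lia.
rewrite -cat1s catA; apply: (looks_like_diagram_of (t := [::])).
exact: (is_closed_box (k := n.+2) hpre').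
Qed.

(** The [Open] of the smoothing is adjacent to the first crossing of the row, so the crossings come
    off one by one from the left, each contributing a factor [va]. *)
Lemma value_infty_row {n i pre post} k : run 0 pre = Some n -> (i.+2 <= n)%N ->
  run n post = Some 0%N ->
  value (pre ++ tangle_infty i ++ row_Xbar k i ++ post) =
    va ^+ k * value (pre ++ tangle_infty i ++ post).
Proof.
move=> hpre hi hpost; elim: k => [|k IH]; first by rewrite mul1r.
rewrite exprS -mulrA -IH.
have split_infty t : pre ++ tangle_infty i ++ t =
    (pre ++ [:: (Close, i)]) ++ [:: (Open, i)] ++ t by rewrite -catA.
rewrite !split_infty.
apply: (value_open_Xbar (n := (n - 2)%N) (post := row_Xbar k i ++ post)).
- by rewrite (run_cat_some _ hpre) run_cons /=; [rewrite addn0|lia].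
- by lia.
- have -> : (n - 2).+2 = n by lia.
  by rewrite (run_cat_some _ (run_nseq_cross _ _ _ _ hi)).
Qed.

Lemma value_skein {n i pre post} : run 0 pre = Some n -> (i.+2 <= n)%N ->
  run n post = Some 0%N ->
  value (pre ++ tangle_Xbar i ++ post) =
    value (pre ++ tangle_X i ++ post)
    - vz * (value (pre ++ post) - value (pre ++ tangle_infty i ++ post)).
Proof.
move=> hpre hi hpost; have cl t : run n t = Some n -> is_closed (pre ++ t ++ post).
  by move=> ht; apply: is_closed_box hpre ht hpost _; lia.
have hcross c : run n [:: (Cross c, i)] = Some n by apply: (run_nseq_cross c n 1).
rewrite -(dubrovnik_skein hP (pre := pre) (post := post) (i := i)
  (KX := diagram_of (pre ++ tangle_X i ++ post))
  (KXbar := diagram_of (pre ++ tangle_Xbar i ++ post))).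
- by rewrite subKr.
- by apply: looks_like_diagram_of; apply: cl; apply: hcross.
- by apply: looks_like_diagram_of; apply: cl; apply: hcross.
- by apply: (looks_like_diagram_of (t := [::])); apply: (cl [::]).
- apply: looks_like_diagram_of; apply: cl.
  rewrite run_cons /=; last by lia.
  by rewrite run_cons /=; [congr Some|]; lia.
Qed.

Lemma value_row_rec {n i pre post} k : run 0 pre = Some n -> (i.+2 <= n)%N ->
  run n post = Some 0%N ->
  value (pre ++ row_Xbar k.+2 i ++ post) =
    value (pre ++ row_Xbar k i ++ post)
    - vz * (value (pre ++ row_Xbar k.+1 i ++ post)
            - va ^+ k.+1 * value (pre ++ tangle_infty i ++ post)).
Proof.
move=> hpre hi hpost.
have hrow l : run n (row_Xbar l i ++ post) = Some 0%N.
  by rewrite (run_cat_some _ (run_nseq_cross _ _ _ _ hi)).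
rewrite -(value_infty_row k.+1 hpre hi hpost) (value_skein hpre hi (hrow k.+1)).
congr (_ - _).
have hcross c c' : run n [:: (Cross c, i); (Cross c', i)] = Some n.
  by rewrite run_cons /= ?addn2 // run_cons /=; [congr Some|]; lia.
(* The switched first crossing cancels with the second one. *)
by apply: (value_rule (ReidemeisterII X i) hpre _ _ (hrow k)) => //; lia.
Qed.

End Values.

(** * The coefficients *)

(* The binomial coefficient vanishes for [n < 2 i], so the range of the sum
   may be extended. *)
Lemma skeinB_widen (n N : nat) : (n %/ 2 < N)%N ->
  skeinB (- n%:Z) =
    \sum_(0 <= i < N) (- vz) ^+ (n - 2 * i) * 'C(n - i, i)%:R.
Proof.
move=> hN; rewrite /skeinB abszN absz_nat.
rewrite [RHS](big_cat_nat (n := (n %/ 2).+1)) //= [X in _ + X]big1_seq ?addr0 //.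
move=> i; rewrite mem_index_iota => /andP[_ /andP[hi _]].
by rewrite bin_small ?mulr0 //; lia.
Qed.

Lemma skeinB0 : skeinB 0 = 1.
Proof. by rewrite /skeinB big_nat1 mulr1. Qed.

Lemma skeinB1 : skeinB (- 1%:Z) = - vz.
Proof. by rewrite /skeinB /= big_nat1 mulr1. Qed.

(** Pascal's rule, applied after splitting off the terms of index 0, separates the two sums on the
    right. *)
Lemma skeinB_rec (n : nat) :
  skeinB (- n.+2%:Z) = - vz * skeinB (- n.+1%:Z) + skeinB (- n%:Z).
Proof.
rewrite (skeinB_widen n.+2 n.+2) ?(skeinB_widen n.+1 n.+2) ?(skeinB_widen n n.+1);
  try lia.
rewrite big_nat_recl // [X in - vz * X]big_nat_recl // mulrDr mulr_sumr -addrA.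
congr (_ + _).
  by rewrite !muln0 !subn0 !bin0 !mulr1 -exprS.
rewrite -big_split; apply: eq_big_nat => i /andP[_ hi] /=.
have [-> -> ->] : [/\ (n.+2 - 2 * i.+1 = n - 2 * i)%N,
  (n.+2 - i.+1 = (n - i).+1)%N & (n.+1 - i.+1 = n - i)%N] by split; lia.
rewrite binS natrD mulrDr; congr (_ + _).
(* Truncated subtraction may break the identity of exponents only where the binomial coefficient
   vanishes. *)
have [h|h] := leqP (2 * i.+1) n.+1; last by rewrite bin_small ?mulr0 //; lia.
rewrite mulrA -exprS; congr (_ ^+ _ * _); lia.
Qed.

(** After the shift of [j] by one, each inner sum is [- vz] times a coefficient [skeinB]. *)
Lemma skeinC_sumB (n : nat) :
  skeinC (- n%:Z) = - vz * \sum_(0 <= j < n) va ^+ (n.-1 - j) * skeinB (- j%:Z).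
Proof.
rewrite /skeinC abszN absz_nat big_add1 mulr_sumr; apply: eq_big_nat => j /andP[_ hj].
rewrite /skeinB abszN absz_nat subn1 /= !mulr_sumr; apply: eq_big_nat => i /andP[_ hi].
have [-> ->] : (j.+1 - 2 * i = (j - 2 * i).+1)%N /\ (n - j.+1 = n.-1 - j)%N
  by split; lia.
by rewrite exprS; ring.
Qed.

Lemma skeinC0 : skeinC 0 = 0.
Proof. by rewrite (skeinC_sumB 0) big_nil mulr0. Qed.

Lemma skeinC_succ (n : nat) :
  skeinC (- n.+1%:Z) = va * skeinC (- n%:Z) - vz * skeinB (- n%:Z).
Proof.
rewrite !skeinC_sumB big_nat_recr //= subnn mul1r mulrDr mulrCA [in X in _ + X]mulNr.
congr (_ * _ - _); rewrite mulr_sumr; apply: eq_big_nat => j /andP[_ hj].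
by rewrite mulrA -exprS; congr (_ ^+ _ * _); lia.
Qed.

(** This is the recurrence of the rows, with the kinks giving the inhomogeneous term. It propagates
    through [skeinC_succ] because [skeinB] satisfies the homogeneous recurrence. *)
Lemma skeinC_rec (n : nat) :
  skeinC (- n.+2%:Z) = - vz * skeinC (- n.+1%:Z) + skeinC (- n%:Z) - vz * va ^+ n.+1.
Proof.
elim: n => [|n IH]; first by rewrite !skeinC_succ skeinB0 skeinB1 skeinC0; ring.
rewrite skeinC_succ {1}IH skeinB_rec (skeinC_succ n.+1) (skeinC_succ n).
by rewrite !exprS; ring.
Qed.

(** The exceptional value at [-1] agrees with [skeinB 0], so the case distinction disappears. *)
Lemma skeinA_succ (n : nat) : skeinA (- n.+1%:Z) = skeinB (- n%:Z).
Proof.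
case: n => [|n]; first by rewrite skeinB0.
rewrite /skeinA; case: eqP => [|_]; first by lia.
by congr skeinB; lia.
Qed.

Theorem theorem3 (P : link_diagram -> ratfun) (hP : is_dubrovnik P)
  (m : int) (hm : m < 0)
  (pre post : seq slice) (i : nat) (L0 Lplus Linfty Lm : link_diagram)
  (h0 : looks_like L0 pre (tangle_0 i) post)
  (hplus : looks_like Lplus pre (tangle_X i) post)
  (hinfty : looks_like Linfty pre (tangle_infty i) post)
  (hm_row : looks_like Lm pre (row_Xbar `|m|%N i) post) :
  P Lm = skeinA m * P Lplus + skeinB m * P L0 - skeinC m * P Linfty.
Proof.
have [n [hpre hi hpost]] := closed_infty_box (looks_like_closed hinfty).
rewrite (value_looks_like P hP h0) (value_looks_like P hP hplus).
rewrite (value_looks_like P hP hinfty) (value_looks_like P hP hm_row).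
have [k ->] : exists k : nat, m = - k.+1%:Z by exists `|m|.-1; lia.
rewrite abszN absz_nat {m hm hm_row h0 hplus hinfty}.
have step1 := value_skein P hP hpre hi hpost.
have rec k' := value_row_rec P hP k' hpre hi hpost.
(* The recurrence reaches back two rows. Row 1 is the skein relation itself, and row 2 refers to the
   empty row, which is [L0] and outside the induction hypothesis. *)
elim/ltn_ind: k => -[|[|k]] IH.
- rewrite [LHS]step1 skeinA_succ skeinC_succ skeinB0 skeinB1 skeinC0.
  rewrite /tangle_0 /=; ring.
- rewrite rec [P (diagram_of (_ ++ row_Xbar 1 i ++ _))]step1.
  rewrite skeinA_succ skeinC_rec skeinC_succ skeinB_rec skeinB0 skeinB1 skeinC0.
  rewrite /tangle_0 /=; ring.
- rewrite rec !IH // !skeinA_succ (skeinC_rec k.+1) (skeinB_rec k.+1) (skeinB_rec k).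
  rewrite (skeinC_rec k); ring.
Qed.
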